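(* The random graph $\mathbf R$ is sociable.
   Context: A graph is a pair $G=(V,E)$ where $E$ is a symmetric and reflexive binary relation on $V$ (every vertex has a loop); $x,y$ are adjacent if $(x,y)\in E$. A graph homomorphism is an edge-preserving map (so it may collapse edges). An embedding is a one-to-one homomorphism $e$ such that $e(x),e(y)$ adjacent implies $x,y$ adjacent. Random graph: $\mathbf R$ is the unique (up to isomorphism) countable graph such that for all disjoint finite sets $A,B\subseteq\mathbf R$ there is a vertex in $\mathbf R\setminus(A\cup B)$ adjacent to all elements of $A$ and to no element of $B$. Sociable graphs: a transition from a finite nonempty graph $G$ to a graph $H$ is a pair $(e,p)$ where $e\colon G\to H$ is an embedding, $p\colon H\to G$ is a homomorphism, $p\circ e=\mathrm{id}_G$, and $H\setminus e[G]$ is either empty (trivial transition) or a single vertex $w$. It is a sociable transition if it is trivial or if the unique vertex $w\in H\setminus e[G]$ is adjacent to $e(p(w))$. A countable (finite or infinite) graph $W$ is sociable if it is obtained from the one-vertex graph $\Theta$ by a finite or infinite composition of sociable transitions; that is, (up to isomorphism) $W=\bigcup_{n\in\omega}G_n$ where $G_0\subseteq G_1\subseteq\dots$ are finite induced subgraphs, $|G_0|=1$, and for each $n$ the inclusion $G_n\subseteq G_{n+1}$ together with some homomorphism $p_n\colon G_{n+1}\to G_n$ is a sociable transition. *)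

(* Defs.v *)
From mathcomp Require Import all_boot.
From mathcomp Require Import boolp classical_sets functions cardinality.

Set Implicit Arguments.
Unset Strict Implicit.
Unset Printing Implicit Defensive.

Local Open Scope classical_set_scope.

Record graph := Graph {
  vertex :> Type;
  adj : vertex -> vertex -> Prop;
  adj_refl : forall x, adj x x;
  adj_sym : forall x y, adj x y -> adj y x
}.

Definition is_hom (G H : graph) (f : G -> H) : Prop :=
  forall x y : G, adj x y -> adj (f x) (f y).

Definition is_embedding (G H : graph) (e : G -> H) : Prop :=
  [/\ injective e, is_hom e & forall x y : G, adj (e x) (e y) -> adj x y].

Definition induced (W : graph) (A : set W) : graph :=
  @Graph A (fun x y => adj (val x) (val y))
    (fun x => adj_refl (val x)) (fun x y => @adj_sym W (val x) (val y)).

Definition inclusion (W : graph) (A B : set W) (AB : A `<=` B) :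
  induced A -> induced B := subfun AB.

Definition is_transition (G H : graph) (e : G -> H) (p : H -> G) : Prop :=
  [/\ finite_set [set: G], [set: G] !=set0, is_embedding e, is_hom p &
      cancel e p /\
      (~` range e = set0 \/ exists w : H, ~` range e = [set w])].

(* The range of w below is empty for a trivial transition, and otherwise
   consists of the single vertex outside the image of e. *)
Definition is_sociable_transition (G H : graph) (e : G -> H) (p : H -> G) :
    Prop :=
  is_transition e p /\ forall w : H, (~` range e) w -> adj w (e (p w)).

(* Finite compositions of sociable transitions are included: the chain may be
   eventually constant, since trivial transitions are sociable. *)
Definition sociable (W : graph) : Prop :=
  countable [set: W] /\
  exists (G : nat -> set W) (GS : forall n, G n `<=` G n.+1),
    [/\ forall n, finite_set (G n),
        exists x : W, G 0 = [set x],
        \bigcup_n G n = [set: W] &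
        forall n, exists p : induced (G n.+1) -> induced (G n),
          is_sociable_transition (inclusion (GS n)) p].

(* These conditions determine the graph up to isomorphism. *)
Definition is_random_graph (R : graph) : Prop :=
  countable [set: R] /\
  forall A B : set R, finite_set A -> finite_set B -> A `&` B = set0 ->
    exists v : R, [/\ ~ (A `|` B) v,
      forall a, A a -> adj v a & forall b, B b -> ~ adj v b].

(* Main.v *)
From mathcomp Require Import all_boot.
From mathcomp Require Import boolp classical_sets functions cardinality.
Require Import Defs.

(* A graph with a vertex c adjacent to everything retracts sociably from any
   one-vertex extension whose new vertex is adjacent to c, by sending the new
   vertex to c. So enumerate the random graph, and before adding each x to the
   current finite graph G, first add a vertex u adjacent to all of G and to x:
   the old apex dominates u, and u is then an apex that dominates x. *)

Set Implicit Arguments.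
Unset Strict Implicit.
Unset Printing Implicit Defensive.

Local Open Scope classical_set_scope.

Lemma inclusion_embedding (W : graph) (A B : set W) (AB : A `<=` B) :
  is_embedding (inclusion AB).
Proof.
split=> [x y /(congr1 val) /= xy|x y|x y] //; exact: val_inj.
Qed.

(** [w] may already lie in [A]: the transition is then trivial, so the chain built later needs no
    check that an added vertex is new. *)
Lemma apex_sociable_transition (W : graph) (A : set W) (c w : W)
    (AB : A `<=` A `|` [set w]) :
  finite_set A -> A c -> (forall a, A a -> adj c a) -> adj c w ->
  exists p : induced (A `|` [set w]) -> induced A,
    is_sociable_transition (inclusion AB) p.
Proof.
move=> finA Ac cA cw.
have memA (y : induced A) : A (val y) by case: y => y /= /set_mem.
have memB (y : induced (A `|` [set w])) : A (val y) \/ val y = w.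
  by case: y => y /= /set_mem.
have cB (y : induced (A `|` [set w])) : adj c (val y).
  by case: (memB y) => [/cA|->].
(* Membership in [A], not equality with [w], decides the value, so [p] is a retraction even when [w]
   is in [A]. *)
have [p pP] : {p : induced (A `|` [set w]) -> induced A & forall y,
    (A (val y) -> val (p y) = val y) /\ (~ A (val y) -> val (p y) = c)}.
  apply: (@choice _ _ (fun y (z : induced A) =>
    (A (val y) -> val z = val y) /\ (~ A (val y) -> val z = c))) => y.
  have [Ay|nAy] := pselect (A (val y)).
    by exists (exist _ (val y) (mem_set Ay)).
  by exists (exist _ c (mem_set Ac)).
have rangeP (y : induced (A `|` [set w])) :
    (~` range (inclusion AB)) y -> ~ A (val y).
  move=> ny Ay; apply: ny; exists (exist _ (val y) (mem_set Ay)) => //.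
  exact: val_inj.
exists p; split; last first.
  by move=> y /rangeP /(pP y).2 /= ->; apply/adj_sym/cB.
split.
- have -> : [set: induced A] = val @^-1` A.
    by apply/seteqP; split=> // x _; exact: memA.
  by apply: finite_preimage => // x y _ _; apply: val_inj.
- by exists (exist _ c (mem_set Ac)).
- exact: inclusion_embedding.
- move=> x y /= xy.
  (* An endpoint outside [A] is sent to [c], which is adjacent to any image of the other
     endpoint. *)
  have [Ax|/(pP x).2 ->] := pselect (A (val x)); last by apply: cA; exact: memA.
  rewrite (pP x).1 //.
  have [Ay|/(pP y).2 ->] := pselect (A (val y)); first by rewrite (pP y).1.
  by apply/adj_sym/cB.
- split.
    by move=> x; apply: val_inj => /=; rewrite (pP (inclusion AB x)).1 //; exact: memA.
  have [[y ny]|/set0P/negP/negPn/eqP] :=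
    pselect ((~` range (inclusion AB)) !=set0); last by left.
  have valw z : (~` range (inclusion AB)) z -> val z = w.
    by move=> /rangeP nAz; case: (memB z).
  right; exists y; apply/seteqP; split=> [z nz|_ ->] //.
  by apply: val_inj; rewrite (valw y) // (valw z).
Qed.

Lemma countable_enum (T : Type) (x0 : T) :
  countable [set: T] -> exists e : nat -> T, forall x, exists n, e n = x.
Proof.
move=> /countable_injP[f finj].
have [e eP] : {e : nat -> T & forall n x, f x = n -> e n = x}.
  apply: (@choice _ _ (fun n y => forall x, f x = n -> y = x)) => n.
  have [[x <-]|nx] := pselect (exists x, f x = n).
    by exists x => y fyx; apply: finj; rewrite ?in_setT.
  (* [x0] is a default at the numbers that [f] misses. *)
  by exists x0 => x fx; case: nx; exists x.
by exists e => x; exists (f x); exact: eP.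
Qed.

Lemma random_graph_common_neighbour (R : graph) (A : set R) :
  is_random_graph R -> finite_set A -> exists v, forall a, A a -> adj v a.
Proof.
move=> [_ /(_ A set0)] ext finA.
have [|v [_ vA _]] := ext finA (finite_set0 _); first exact: setI0.
by exists v.
Qed.

Theorem corollary7p2 (R : graph) (R_random : is_random_graph R) : sociable R.
Proof.
have [x0 _] := random_graph_common_neighbour R_random (finite_set0 _).
have [e eP] := countable_enum x0 R_random.1.
have [apex apexP] : {apex : set R -> R & forall A, finite_set A ->
    forall a, A a -> adj (apex A) a}.
  apply: (@choice _ _ (fun A v => finite_set A -> forall a, A a -> adj v a)).
  move=> A; have [finA|nfinA] := pselect (finite_set A); last by exists x0.
  by have [v vA] := random_graph_common_neighbour R_random finA; exists v.
split; first exact: R_random.1.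
(* Stages [2k] and [2k+1] both treat [e k]: the first adds a vertex adjacent to [e k] and to all of
   [A], the second adds [e k] itself. *)
pose next n A := if odd n then e n./2 else apex (A `|` [set e n./2]).
pose fix G n := if n is m.+1 then G m `|` [set next m (G m)] else [set x0].
have finG n : finite_set (G n).
  by elim: n => [|n IH] /=; [|rewrite finite_setU; split].
have next_even n a : ~~ odd n -> (G n `|` [set e n./2]) a ->
    adj (next n (G n)) a.
  move=> /negPf evn; rewrite /next evn; apply: apexP.
  by rewrite finite_setU; split.
(* Adjacency to the coming vertex is part of the invariant: after an odd stage the same [c] still
   dominates, after an even stage the vertex just added takes over. *)
have G_apex n : exists c,
    [/\ G n c, forall a, G n a -> adj c a & adj c (next n (G n))].
  elim: n => [|n [c [Gc cG cnext]]].
    exists x0; split=> // [a ->|]; first exact: adj_refl.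
    by apply/adj_sym/next_even => //; left.
  have [oddn|evenn] := boolP (odd n).
    exists c; have cG' a : G n.+1 a -> adj c a by case=> [/cG|->].
    split=> //; first by left.
    by apply/adj_sym/next_even; [rewrite /= negbK|left; left].
  exists (next n (G n)); split; first by right.
    move=> a [Ga|->]; last exact: adj_refl.
    by apply: next_even => //; left.
  (* For even [n], halving [n.+1] gives [n./2], so the coming vertex is the one the new apex was
     chosen to meet. *)
  rewrite [next n.+1 _]/next /= evenn uphalf_half (negPf evenn).
  by apply: next_even => //; right.
have GS n : G n `<=` G n.+1 by move=> x; left.
exists G, GS; split=> //.
- by exists x0.
- apply/seteqP; split=> // x _; have [n <-] := eP x.
  (* [e n] is added at stage [2n+1], hence first guaranteed in [G] at index [2n+2]. *)
  exists n.*2.+2 => //; right.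
  by rewrite /next /= odd_double /= uphalf_double.
- move=> n; have [c [Gc cG cnext]] := G_apex n.
  exact: apex_sociable_transition cnext.
Qed.
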